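(* Let $q$ be an odd prime power and let $n\ge 1$ be an integer. Suppose that $A\subset(\mathbb{Z}/q\mathbb{Z})^n$ satisfies $|A|>\gamma_q^n$, where $$\gamma_q=\min_{0<x<1}\frac{1-x^{q}}{1-x}\,x^{-\frac{q-1}{q}} .$$ Then $A$ contains $q$ not necessarily distinct, but not all equal, elements $x_1,\dots,x_q$ such that $x_1+\cdots+x_q=0$. *)

(* Defs.v *)
From mathcomp Require Import all_boot all_order all_algebra.
From mathcomp Require Import all_classical all_reals all_analysis.
From mathcomp Require Import ring lra.

Set Implicit Arguments.
Unset Strict Implicit.
Unset Printing Implicit Defensive.

Import Order.TTheory GRing.Theory Num.Theory.
Import numFieldNormedType.Exports.

Local Open Scope classical_set_scope.
Local Open Scope ring_scope.

Definition prime_power (q : nat) : Prop :=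
  exists p k : nat, [/\ prime p, (0 < k)%N & q = (p ^ k)%N].

Definition gamma_fun (R : realType) (q : nat) (x : R) : R :=
  (1 - x ^+ q) / (1 - x) * x `^ (- ((q%:R - 1) / q%:R)).

(* For q > 2 the infimum is attained, i.e. it is a minimum: see [gammaP].  (For
   q = 2 it is only approached as x tends to 1.) *)
Definition gamma (R : realType) (q : nat) : R :=
  inf [set gamma_fun q x | x in [set x : R | 0 < x < 1]].

Lemma gammaP (R : realType) (q : nat) : (2 < q)%N ->
  (exists2 x : R, 0 < x < 1 & gamma R q = gamma_fun q x) /\
  (forall x : R, 0 < x < 1 -> gamma R q <= gamma_fun q x).
Proof.
move=> q2.
have q3 : (3 : R) <= q%:R by rewrite ler_nat.
set c : R := (q%:R - 1) / q%:R.
have c0 : 0 < c by rewrite divr_gt0; lra.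
pose S (x : R) := \sum_(i < q) x ^+ i.
pose g (x : R) := S x * expR (- c * ln x).
have gE x : 0 < x < 1 -> gamma_fun q x = g x.
  move=> /andP[x0 x1]; rewrite /gamma_fun /g /powR gt_eqF//; congr (_ * _).
  have x1' : 1 - x != 0 by rewrite subr_eq0 gt_eqF.
  rewrite -opprB subrX1 -mulNr opprB mulrAC divff// mul1r.
  by apply: eq_bigr.
have S1 x : 0 < x -> 1 <= S x.
  move=> x0; rewrite /S -(subnKC (ltnW (ltnW q2))) big_ord_recl expr0 lerDl.
  by apply: sumr_ge0 => i _; rewrite exprn_ge0// ltW.
have g1 : g 1 = q%:R.
  rewrite /g ln1 mulr0 expR0 mulr1 /S.
  under eq_bigr do rewrite expr1n.
  by rewrite sumr_const card_ord.
have g34 : g (3 / 4) < q%:R.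
  have HS : S (3 / 4) <= (10 + 9 * q%:R) / 16.
    rewrite /S -(subnKC (ltnW q2)) !big_ord_recl/= expr0 expr1.
    apply: (@le_trans _ _ (1 + (3 / 4 + \sum_(i < q - 2) (9 / 16 : R)))).
      rewrite lerD2l lerD2l; apply: ler_sum => i _.
      rewrite /bump/= !add1n !exprS mulrA.
      have : (3 / 4 : R) ^+ i <= 1 by rewrite exprn_ile1//; lra.
      by lra.
    rewrite sumr_const card_ord -[_ *+ (q - 2)]mulr_natr natrD natrB; last exact: ltnW.
    by lra.
  rewrite /g mulNr expRN ltr_pdivrMr ?expR_gt0//.
  apply: (le_lt_trans HS).
  have h1 : (2 * q%:R + 1) / (3 * q%:R) <= expR (c * ln (3 / 4)).
    apply: le_trans (expR_ge1Dx _).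
    have -> : ln (3 / 4 : R) = - ln (4 / 3).
      rewrite -lnV ?posrE; last by lra.
      by congr ln; field.
    have h2 : ln (4 / 3 : R) <= 1 / 3.
      by have := @le_ln1Dx R (1 / 3) ltac:(lra); congr (ln _ <= _); field.
    have -> : (2 * q%:R + 1) / (3 * q%:R) = 1 - c * (1 / 3) :> R.
      by rewrite /c; field; lra.
    by rewrite mulrN lerD2l lerN2 ler_pM2l.
  apply: lt_le_trans (_ : q%:R * ((2 * q%:R + 1) / (3 * q%:R)) <= _).
    have -> : q%:R * ((2 * q%:R + 1) / (3 * q%:R)) = (2 * q%:R + 1) / 3 :> R.
      by field; lra.
    by lra.
  by rewrite ler_pM2l//; lra.
pose e : R := expR (- (ln q%:R / c)).
have e0 : 0 < e by exact: expR_gt0.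
have ge x : 0 < x -> x <= e -> q%:R <= g x.
  move=> x0 xe; have q0 : (0 : R) < q%:R by lra.
  apply: (@le_trans _ _ (expR (- c * ln x))); last first.
    by rewrite ler_peMl ?expR_ge0// S1.
  rewrite -[leLHS]lnK// ler_expR.
  have : ln x <= - (ln q%:R / c) by rewrite -[leRHS]expRK ler_ln.
  rewrite -(ler_pM2l c0) mulrN mulrCA divff ?mulr1; last by rewrite gt_eqF.
  by rewrite mulNr; lra.
have e34 : e < 3 / 4.
  have p34 : (0 : R) < 3 / 4 by lra.
  by rewrite ltNge; apply/negP => /(ge _ p34); rewrite leNgt g34.
have [||m] := @EVT_min R g e 1; first by lra.
  apply: continuous_in_subspaceT => x; rewrite inE/= in_itv/= => /andP[ex _].
  have x0 : 0 < x by exact: lt_le_trans ex.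
  apply: cvgM; last first.
    apply: continuous_comp; last exact: continuous_expR.
    by apply: cvgM; [exact: cvg_cst|exact: continuous_ln].
  by apply: cvg_big => [|i _]; [exact: add_continuous|exact: exprn_continuous].
rewrite in_itv/= => /andP[em m1] mP.
have gm : g m < q%:R.
  by apply: le_lt_trans g34; apply: mP; rewrite in_itv/=; lra.
have m01 : 0 < m < 1.
  rewrite (lt_le_trans e0 em) lt_neqAle m1 andbT.
  by apply: contraTneq gm => ->; rewrite g1 ltxx.
have mlb x : 0 < x < 1 -> gamma_fun q m <= gamma_fun q x.
  move=> x01; rewrite !gE//; have /andP[x0 x1] := x01.
  have [xe|ex] := leP x e; first exact: le_trans (ltW gm) (ge _ x0 xe).
  by apply: mP; rewrite in_itv/= !ltW.
have lb : lbound [set gamma_fun q x | x in [set x : R | 0 < x < 1]]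
    (gamma_fun q m) by move=> _ [x x01 <-]; exact: mlb.
have gmE : gamma R q = gamma_fun q m.
  apply/eqP; rewrite eq_le; apply/andP; split.
    by apply: ge_inf; [exists (gamma_fun q m)|exists m].
  by apply: lb_le_inf => //; exists (gamma_fun q m); exists m.
by split; [exists m|move=> x x01; rewrite gmE; exact: mlb].
Qed.

(* Main.v *)
(* The polynomial (slice rank) method.  Let F have characteristic p and q = p^k.
   The coefficient of X^(q-1) in (1 + X)^(y + q - 1) is the indicator of q | y
   in F.  Applied coordinatewise to a sum of q vectors, this writes the indicator
   of a zero sum as a combination of products m_1(x_1) ... m_q(x_q) of monomials
   of total degree at most N(q-1), one of which therefore has degree at most
   N(q-1)/q.  If only constant families sum to zero, then pairing with functions
   u_1, ..., u_q orthogonal to all such low-degree monomials gives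
   sum_s u_1(s) ... u_q(s) = 0, which forces the space of these functions to have
   dimension at most |S|/2; hence |S| is at most twice the number of low-degree
   monomials, i.e. at most 2 gamma^N.  The factor 2 disappears by replacing A with
   the power A^m and letting m grow. *)

Require Import Defs.
From mathcomp Require Import all_boot all_order all_algebra.
From mathcomp Require Import all_classical all_reals all_analysis.
From mathcomp Require Import lra zify.

Set Implicit Arguments.
Unset Strict Implicit.
Unset Printing Implicit Defensive.

Import Order.TTheory GRing.Theory Num.Theory.

Local Open Scope ring_scope.

(** Fixing all but two arguments leaves a bilinear form [K D K^T] with [D] diagonal. Its vanishing
    gives [rank (K D) + rank K^T <= N], and [D] is chosen so that [K D] keeps rank [w]. *)
Lemma isotropic_rank (F : fieldType) (q N w : nat) (K : 'M[F]_(w, N)) :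
    (1 < q)%N -> row_free K ->
    (forall u : 'I_q -> 'rV[F]_N, (forall i, (u i <= K)%MS) ->
      \sum_s \prod_i u i 0 s = 0) ->
  (w + w <= N)%N.
Proof.
case: q => [|[|q]]// _ freeK isoK.
have fullK : row_full K^T by rewrite /row_full mxrank_tr.
set g := fullrankfun fullK.
have unitK : colsub g K \in unitmx.
  by rewrite -unitmx_tr trmx_mxsub; exact: fullrowsub_unit.
(* Fixing q - 2 of the arguments to be h, the form becomes K diag(h^(q-2)) K^T,
   where h is nowhere zero on a set of w independent columns. *)
have [h hK hg] : exists2 h : 'rV_N, (h <= K)%MS & forall t, h 0 (g t) = 1.
  exists (const_mx 1 *m invmx (colsub g K) *m K); first exact: submxMl.
  move=> t; have : colsub g (const_mx 1 *m invmx (colsub g K) *m K)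
      = const_mx 1 :> 'rV_w by rewrite -mulmx_colsub mulmxKV.
  by move/rowP/(_ t); rewrite !mxE.
(* The case analysis has replaced the number of arguments by [q.+2], so the exponent [q] counts the
   arguments set to [h]. *)
pose d := \row_s h 0 s ^+ q.
have /mulmx0_rank_max : K *m diag_mx d *m K^T = 0.
  apply/matrixP => i j; rewrite mul_mx_diag !mxE.
  pose u (k : 'I_q.+2) := if k == 0 then row i K else
    if k == lift 0 0 then row j K else h.
  rewrite -[RHS](isoK u) => [|k]; last first.
    by rewrite /u; case: ifP => _; last case: ifP => _; rewrite ?row_sub.
  apply: eq_bigr => s _; rewrite !mxE big_ord_recl big_ord_recl /u/=.
  by rewrite prodr_const card_ord !mxE -mulrA [_ ^+ q * _]mulrC.
apply: leq_trans; rewrite leq_add// ?mxrank_tr; last by rewrite (eqP freeK).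
have KdE : colsub g (K *m diag_mx d) = colsub g K.
  by apply/matrixP => i t; rewrite mul_mx_diag !mxE hg expr1n mulr1.
rewrite -[leqLHS](mxrank_unit unitK) -KdE -{1}[K *m diag_mx d]mulmx1.
by rewrite -mulmx_colsub mxrankM_maxl.
Qed.

Lemma size_exp_XD1 (F : fieldType) n : size (('X + 1 : {poly F}) ^+ n) = n.+1.
Proof. by rewrite -[1]opprK -polyC1 -polyCN size_exp_XsubC. Qed.

(** By Frobenius [(X + 1)^q = X^q + 1], so modulo [X^q] only [(X + 1)^b] remains, where [b] is the
    residue of [y + q - 1] modulo [q]. Its degree is [q - 1] exactly when [q] divides [y]. *)
Lemma coef_exp_XD1_pred (F : fieldType) (p k y : nat) :
    p \in [pchar F] ->
  ((('X + 1 : {poly F}) ^+ (y + (p ^ k).-1))`_(p ^ k).-1) = (p ^ k %| y)%N%:R.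
Proof.
move=> charp; set q := (p ^ k)%N.
have q0 : (0 < q)%N by rewrite expn_gt0 (prime_gt0 (pcharf_prime charp)).
have frob : ('X + 1 : {poly F}) ^+ q = 'X^q + 1.
  rewrite exprDn_pchar ?expr1n// pnatX; apply/orP; left.
  rewrite pnatE ?(pcharf_prime charp)//; apply/andP; split.
    exact: pcharf_prime charp.
  by rewrite -polyC_natr (pcharf0 charp).
have [r rE] : exists r, ('X^q + 1 : {poly F}) ^+ ((y + q.-1) %/ q) = r * 'X^q + 1.
  elim: (_ %/ _)%N => [|a [r rE]]; first by exists 0; rewrite mul0r add0r.
  exists (r * ('X^q + 1) + 1); rewrite exprSr rE.
  by rewrite mulrDl mul1r [in RHS]mulrDl mul1r mulrAC addrA.
rewrite [X in _ ^+ X](divn_eq _ q) exprD mulnC exprM frob rE mulrDl mul1r.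
rewrite mulrAC coefD coefMXn ltn_predL q0 add0r.
set b := (_ %% q)%N.
have sizeE : size (('X + 1 : {poly F}) ^+ b) = b.+1.
  exact: size_exp_XD1.
have bq : (b <= q.-1)%N by rewrite -ltnS prednK// ltn_mod.
have -> : (q %| y)%N = (b == q.-1).
  rewrite /b {2}(divn_eq y q) /dvdn; case: (y %% q)%N (ltn_mod y q) => [|r'].
    by rewrite addn0 modnMDl modn_small ?ltn_predL ?eqxx.
  rewrite q0 => r'q; have -> : (y %/ q * q + r'.+1 + q.-1 = (y %/ q).+1 * q + r')%N.
    by rewrite mulSn; lia.
  rewrite modnMDl modn_small; lia.
case: eqP => [<-|/eqP bnq]; last by rewrite nth_default ?sizeE// ltn_neqAle bnq.
transitivity (lead_coef (('X + 1 : {poly F}) ^+ b)).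
  by rewrite lead_coefE sizeE.
by rewrite lead_coef_exp lead_coefDl ?size_polyX ?size_poly1// lead_coefX expr1n.
Qed.

(* [mono v j] plays the role of the monomial prod_c 'C(v_c, j_c) of degree
   sum_c j_c, written with the coefficients of (X + 1)^(v_c). *)
Definition mono (F : fieldType) (q : nat) (I : finType) (v : I -> 'I_q)
  (j : {ffun I -> 'I_q}) : F := \prod_c (('X + 1 : {poly F}) ^+ v c)`_(j c).

Definition low_degree (q : nat) (I : finType) :=
  [pred j : {ffun I -> 'I_q} | (q * \sum_c j c <= #|I| * q.-1)%N].

(** The factor at [c] is the binomial coefficient 'C(q - 1, s) in [F], with [s] the sum of the
    exponents at [c]; it vanishes for [s > q - 1]. *)
Definition zero_sum_coef (F : fieldType) (q : nat) (I : finType)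
    (J : {ffun 'I_q -> {ffun I -> 'I_q}}) : F :=
  \prod_c (('X + 1 : {poly F}) ^+ q.-1 * 'X^(\sum_i J i c))`_q.-1.

(** Pigeonhole: every coordinate carries exponents of sum at most [q - 1], so the [q] monomials
    share a total degree of at most [#|I| (q - 1)]. *)
Lemma zero_sum_coef_neq0 (F : fieldType) (q : nat) (I : finType)
    (J : {ffun 'I_q -> {ffun I -> 'I_q}}) : (0 < q)%N ->
  zero_sum_coef F J != 0 -> [exists i, low_degree q I (J i)].
Proof.
move=> q0 /prodf_neq0 J0; apply: contraT => /existsPn highJ.
have degJ c : (\sum_i J i c <= q.-1)%N.
  by have := J0 c isT; rewrite coefMXn; case: ltnP => //; rewrite eqxx.
have : (\sum_(i < q) (#|I| * q.-1).+1 <= \sum_(i < q) q * \sum_c J i c)%N.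
  by apply: leq_sum => i _; have := highJ i; rewrite /= -ltnNge.
rewrite sum_nat_const card_ord -big_distrr/= leq_pmul2l// exchange_big/=.
rewrite ltnNge => /negP[]; rewrite -sum_nat_const.
by apply: leq_sum => c _; exact: degJ.
Qed.

Lemma zero_sum_expansion (F : fieldType) (p k : nat) (q := (p ^ k)%N)
    (I S : finType) (v : S -> I -> 'I_q) (x : 'I_q -> S) : p \in [pchar F] ->
  \prod_c (q %| \sum_i v (x i) c)%N%:R =
  \sum_(J : {ffun 'I_q -> {ffun I -> 'I_q}})
    zero_sum_coef F J * \prod_i mono F (v (x i)) (J i).
Proof.
move=> charp.
have factorE c : (q %| \sum_i v (x i) c)%N%:R = \sum_(f : {ffun 'I_q -> 'I_q})
    (('X + 1 : {poly F}) ^+ q.-1 * 'X^(\sum_i f i))`_q.-1 *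
    \prod_i (('X + 1 : {poly F}) ^+ v (x i) c)`_(f i).
  have expXD1E (y : 'I_q) : ('X + 1 : {poly F}) ^+ y =
      \sum_(j < q) (('X + 1 : {poly F}) ^+ y)`_j *: 'X^j.
    rewrite -poly_def; apply/polyP => j; rewrite coef_poly.
    by case: ltnP => // qj; rewrite nth_default// size_exp_XD1 (leq_trans _ qj).
  rewrite -(coef_exp_XD1_pred _ _ charp) -/q exprD mulrC -prodrXr.
  under eq_bigr do rewrite expXD1E.
  rewrite bigA_distr_bigA mulr_sumr coef_sum; apply: eq_bigr => f _.
  by rewrite scaler_prod prodrXr -scalerAr coefZ mulrC.
under eq_bigr do rewrite factorE.
rewrite bigA_distr_bigA/=.
(* Distributing the product over coordinates yields families indexed by coordinate first;
   transposing them groups the exponents by argument. *)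
pose tr (A B : finType) (T : finType) (f : {ffun A -> {ffun B -> T}}) :=
  [ffun b => [ffun a => f a b]].
rewrite (reindex (@tr 'I_q I 'I_q)); last first.
  by exists (@tr I 'I_q 'I_q) => f _; apply/ffunP => a; apply/ffunP => b; rewrite !ffunE.
apply: eq_bigr => J _; rewrite big_split/=; congr (_ * _).
  by apply: eq_bigr => c _; congr (_ * 'X^_)`_ _; apply: eq_bigr => i _; rewrite !ffunE.
by rewrite exchange_big; apply: eq_bigr => i _; apply: eq_bigr => c _; rewrite !ffunE.
Qed.

(** The functions orthogonal to the low-degree monomials form the left kernel of [L], of dimension
    at least [#|S| - #|low|], and isotropy bounds this dimension by [#|S| / 2]. *)
Lemma card_zero_sum_free (p k : nat) (q := (p ^ k)%N) (I S : finType)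
    (v : S -> I -> 'I_q) : prime p -> (1 < q)%N ->
    (forall x : 'I_q -> S,
      (forall c, q %| \sum_i v (x i) c)%N -> forall i j, x i = x j) ->
  (#|S| <= 2 * #|low_degree q I|)%N.
Proof.
move=> prp q1 free; have q0 := ltnW q1.
have charp := pchar_Fp prp.
set low := low_degree q I.
pose L : 'M['F_p]_(#|S|, #|low|) :=
  \matrix_(s, t) mono 'F_p (v (enum_val s)) (enum_val t).
have Lorth (u : 'rV_#|S|) j : (u <= kermx L)%MS -> low j ->
    \sum_s u 0 (enum_rank s) * mono 'F_p (v s) j = 0.
  move=> /sub_kermxP uL lowj.
  transitivity ((u *m L) 0 (enum_rank_in lowj j)); last by rewrite uL mxE.
  rewrite mxE (reindex (@enum_val S S)) /=; last first.
    by exists enum_rank => s _; rewrite ?enum_valK ?enum_rankK.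
  by apply: eq_bigr => s _; rewrite mxE enum_valK enum_rankK_in.
have isoL (u : 'I_q -> 'rV_#|S|) : (forall i, u i <= kermx L)%MS ->
    \sum_s \prod_i u i 0 s = 0.
  move=> uL.
  have zeroE (x : {ffun 'I_q -> S}) : \prod_c (q %| \sum_i v (x i) c)%N%:R =
      (x == [ffun=> x (Ordinal q0)])%:R :> 'F_p.
    have [xE|xN] := eqVneq.
      apply: big1 => c _; rewrite xE.
      under eq_bigr do rewrite ffunE.
      by rewrite sum_nat_const card_ord dvdn_mulr.
    apply/eqP/prodf_eq0.
    have [c cN] : exists c, ~~ (q %| \sum_i v (x i) c)%N.
      apply/existsP; apply: contraNT xN => /existsPn zx.
      by apply/eqP/ffunP => i; rewrite ffunE; apply: free => c; exact/negPn.
    by exists c; rewrite // (negbTE cN).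
  (* The diagonal sum becomes a sum over all families weighted by the zero-sum indicator, whose
     expansion separates the arguments. *)
  transitivity (\sum_(x : {ffun 'I_q -> S}) (\prod_i u i 0 (enum_rank (x i))) *
      \prod_c (q %| \sum_i v (x i) c)%N%:R).
    under [RHS]eq_bigr do rewrite zeroE mulr_natr mulrb.
    rewrite -big_mkcond/= (reindex_onto (fun s => [ffun=> s])
      (fun x : {ffun 'I_q -> S} => x (Ordinal q0)))/=; last by move=> x /eqP.
    rewrite (reindex (@enum_val S S)) /=; last first.
      by exists enum_rank => s _; rewrite ?enum_valK ?enum_rankK.
    apply: eq_big => [s|s _]; first by rewrite !ffunE !eqxx.
    by apply: eq_bigr => i _; rewrite ffunE enum_valK.
  under eq_bigr do rewrite zero_sum_expansion// mulr_sumr.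
  rewrite exchange_big big1//= => J _.
  have [->|/(zero_sum_coef_neq0 q0)/existsP[i lowi]] :=
    eqVneq (zero_sum_coef 'F_p J) 0.
    by rewrite big1// => x _; rewrite mul0r mulr0.
  under eq_bigr do rewrite mulrCA -big_split/=.
  rewrite -mulr_sumr -(bigA_distr_bigA
    (fun i s => u i 0 (enum_rank s) * mono 'F_p (v s) (J i))).
  by rewrite (bigD1 i)//= Lorth// mul0r mulr0.
have : (\rank (kermx L) + \rank (kermx L) <= #|S|)%N.
  apply: (isotropic_rank (K := row_base (kermx L)) q1 (row_base_free _)) => u uK.
  by apply: isoL => i; rewrite (submx_trans (uK i)) ?eq_row_base.
have := rank_leq_col L; rewrite mxrank_ker; lia.
Qed.

(** As [x < 1], every low-degree [j] has weight [x^(deg j)] at least [x^(c #|I|)], while the weights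
    of all [j] add up to [(1 + x + ... + x^(q-1))^#|I|]. *)
Lemma low_degree_bound (R : realType) (q : nat) (I : finType) (x : R) :
    (0 < q)%N -> 0 < x < 1 ->
  #|low_degree q I|%:R <= gamma_fun q x ^+ #|I|.
Proof.
move=> q0 /andP[x0 x1]; rewrite /gamma_fun.
set c : R := (q%:R - 1) / q%:R; set y := x `^ c.
have y0 : 0 < y by exact: powR_gt0.
have -> : (1 - x ^+ q) / (1 - x) = \sum_(i < q) x ^+ i.
  rewrite -opprB subrX1 -mulNr opprB mulrAC divff ?mul1r//.
  by rewrite subr_eq0 gt_eqF.
rewrite powRN -/y exprMn exprVn ler_pdivlMr ?exprn_gt0//.
have -> : (\sum_(i < q) x ^+ i) ^+ #|I| =
    \sum_(j : {ffun I -> 'I_q}) x ^+ (\sum_c j c).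
  rewrite -prodr_const bigA_distr_bigA.
  by apply: eq_bigr => j _; rewrite prodrXr.
rewrite mulr_natl -sumr_const.
apply: (@le_trans _ _ (\sum_(j in low_degree q I) x ^+ (\sum_c j c))).
  apply: ler_sum => j /=; rewrite inE => lowj.
  rewrite -!powR_mulrn ?(ltW x0) ?(ltW y0)// -powRrM ger_powR ?x0 ?(ltW x1)//.
  rewrite /c mulrAC ler_pdivlMr ?ltr0n// mulrC.
  by rewrite [leRHS]mulrC -[1 in leRHS]/1%:R -natrB// subn1 -!natrM ler_nat.
by rewrite big_mkcond/= ler_sum// => j _; case: ifP => // _; rewrite exprn_ge0// ltW.
Qed.

Lemma exp_bounded_le1 (R : archiRealFieldType) (r b : R) :
  (forall m, r ^+ m <= b) -> r <= 1.
Proof.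
move=> rb; rewrite leNgt; apply/negP => r1.
have bern m : 1 + m%:R * (r - 1) <= r ^+ m.
  elim: m => [|m IH]; first by rewrite mul0r addr0 expr0.
  rewrite exprS; have := ler_wpM2l (ltW (lt_trans ltr01 r1)) IH.
  apply: le_trans; rewrite -natr1.
  have : 0 <= m%:R * (r - 1) * (r - 1) by rewrite !mulr_ge0// subr_ge0 ltW.
  lra.
have := archi_boundP (normr_ge0 (b / (r - 1))).
set m := Num.bound _ => bm.
have : b / (r - 1) < m%:R by apply: le_lt_trans bm; rewrite ler_norm.
rewrite ltr_pdivrMr ?subr_gt0// => bm'.
have := rb m; have := bern m; lra.
Qed.

Theorem theorem2 (R : realType) (q n : nat) (hq : prime_power q)
    (hodd : odd q) (hn : (1 <= n)%N) (A : {set 'rV['Z_q]_n})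
    (hA : gamma R q ^+ n < #|A|%:R) :
  exists x : 'I_q -> 'rV['Z_q]_n,
    [/\ forall i, x i \in A,
        exists i j, x i <> x j
      & \sum_(i < q) x i = 0].
Proof.
have [p [k [prp k0 qE]]] := hq.
have q1 : (1 < q)%N.
  by rewrite qE (leq_trans (prime_gt1 prp))// -{1}[p]expn1 leq_exp2l ?prime_gt1.
(* Oddness rules out [q = 2], so the infimum [gamma] is attained at some [x]. *)
have q2 : (2 < q)%N by rewrite ltn_neqAle q1 andbT; apply: contraTneq hodd => <-.
have [[x x01 gE] _] := gammaP R q2.
apply: contrapT => noA.
have constA (y : 'I_q -> 'rV['Z_q]_n) : (forall i, y i \in A) ->
    \sum_i y i = 0 -> forall i j, y i = y j.
  move=> yA y0 i j; apply: contrapT => yij; apply: noA.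
  by exists y; split => //; exists i, j.
pose toI (a : 'Z_q) : 'I_q := cast_ord (Zp_cast q1) a.
have bound m : (#|A| ^ m <= 2 * #|low_degree q ('I_m * 'I_n)%type|)%N.
  (* [S] is the power [A^m]: a zero sum there is a zero sum in each of the [m] components, to which
     [constA] applies. *)
  pose S := {ffun 'I_m -> {a | a \in A}}.
  pose v (s : S) (c : 'I_m * 'I_n) := toI (val (s c.1) 0 c.2).
  have <- : #|{: S}| = (#|A| ^ m)%N by rewrite card_ffun card_sig card_ord.
  subst q; apply: (card_zero_sum_free (v := v)) => // y y0 i j.
  apply/ffunP => t; apply: val_inj.
  apply: (constA (fun i => val (y i t))) => [i'|]; first exact: valP.
  apply/rowP => c; rewrite summxE mxE.
  have := y0 (t, c); rewrite /v/= => /dvdnP[d dE].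
  have -> : \sum_i0 \val (y i0 t) 0 c = (\sum_i0 (\val (y i0 t) 0%R c : nat))%N%:R.
    by rewrite natr_sum; apply: eq_bigr => i' _; rewrite natr_Zp.
  by rewrite dE natrM pchar_Zp// mulr0.
have gpos : 0 < gamma R q.
  rewrite gE /gamma_fun mulr_gt0 ?powR_gt0 ?divr_gt0 ?subr_gt0//; case/andP: x01 => //.
  by move=> x0 x1; rewrite exprn_ilt1 ?ltW// -lt0n ltnW.
have gn0 : 0 < gamma R q ^+ n by rewrite exprn_gt0.
suff : #|A|%:R / gamma R q ^+ n <= 1.
  by rewrite ler_pdivrMr// mul1r leNgt hA.
(* The constant 2 is the loss in [card_zero_sum_free], which does not depend on [m]. *)
apply: (@exp_bounded_le1 _ _ 2) => m.
rewrite exprMn exprVn ler_pdivrMr ?exprn_gt0// -exprM.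
have := low_degree_bound ('I_m * 'I_n)%type (ltnW q1) x01.
rewrite -gE card_prod !card_ord mulnC => lowB.
have := bound m; rewrite -(ler_nat R) natrX natrM.
move=> /le_trans; apply.
by rewrite ler_pM2l.
Qed.
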